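(* Let $M$ be a compact, connected, oriented Riemannian manifold and let $P:\mathscr{D}'(M)\to\mathscr{D}'(M)$ be a continuous linear operator that maps $\mathscr{C}^\infty(M)$ into itself. Suppose that the kernel of ${}^{\mathrm t}P:\mathscr{C}^\infty(M)\to\mathscr{C}^\infty(M)$ is dense in the kernel of ${}^{\mathrm t}P:\mathscr{D}'(M)\to\mathscr{D}'(M)$. Then for every $f\in\mathscr{C}^\infty(M)$ the condition $$\langle f,v\rangle=0\quad\text{for every } v\in\mathscr{C}^\infty(M)\text{ such that }{}^{\mathrm t}Pv=0$$ implies the condition $$\langle v,f\rangle=0\quad\text{for every } v\in\mathscr{D}'(M)\text{ such that }{}^{\mathrm t}Pv=0.$$ If, moreover, $P:\mathscr{C}^\infty(M)\to\mathscr{C}^\infty(M)$ has closed range, then $P$ is almost globally hypoelliptic (AGH) in $M$ and weakly globally solvable.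
   Context: $\mathscr{D}'(M)$ is the space of distributions on $M$, i.e. the topological dual of $\mathscr{C}^\infty(M)$, endowed with the strong dual topology (density above refers to this topology); functions are identified with distributions through the Riemannian volume form. ${}^{\mathrm t}P$ denotes the transpose of $P$ for the duality between $\mathscr{C}^\infty(M)$ and $\mathscr{D}'(M)$; by reflexivity it is also a continuous operator on $\mathscr{D}'(M)$ mapping $\mathscr{C}^\infty(M)$ into itself. $P$ is almost globally hypoelliptic (AGH) in $M$ if for every $u\in\mathscr{D}'(M)$ with $Pu\in\mathscr{C}^\infty(M)$ there exists $v\in\mathscr{C}^\infty(M)$ such that $Pv=Pu$. $P$ is weakly globally solvable if for every $f\in\mathscr{C}^\infty(M)$ satisfying $\langle f,v\rangle=0$ for every $v\in\mathscr{C}^\infty(M)$ with ${}^{\mathrm t}Pv=0$, there exists $u\in\mathscr{D}'(M)$ such that $Pu=f$. *)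

(* Defs.v *)
From HB Require Import structures.
From mathcomp Require Import all_boot all_order all_algebra.
From mathcomp Require Import complex.
From mathcomp Require Import ring.
From mathcomp Require Import all_classical all_reals all_analysis.

Set Implicit Arguments.
Unset Strict Implicit.
Unset Printing Implicit Defensive.

Import Order.TTheory GRing.Theory Num.Theory.
Import numFieldNormedType.Exports.

Local Open Scope classical_set_scope.
Local Open Scope ring_scope.

Section smooth_Rn.
Context {R : realType} {n : nat}.
Implicit Types (F G : 'rV[R]_n -> R) (U : set 'rV[R]_n).

Definition iter_partial (s : seq 'I_n) F : 'rV[R]_n -> R :=
  foldr (fun j G => 'D_(delta_mx 0 j) G) F s.

(* Meant for open U, where it says that F is C^oo on U.                       *)
Definition smooth_on U F := forall s x, U x ->
  {for x, continuous (iter_partial s F)} /\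
  forall j, derivable (iter_partial s F) x (delta_mx 0 j).

Lemma near_eq_derive F G (x v : 'rV[R]_n) :
  (\forall y \near x, F y = G y) ->
  (derivable F x v -> derivable G x v) /\ 'D_v F x = 'D_v G x.
Proof.
move=> FG.
have FGx : F x = G x by exact: nbhs_singleton FG.
have H : \forall h \near 0^',
    h^-1 *: ((F \o shift x) (h *: v) - F x) =
    h^-1 *: ((G \o shift x) (h *: v) - G x).
  rewrite FGx; apply: nbhs_dnbhs.
  have c : (fun h : R => h *: v + x) h @[h --> 0] --> x.
    rewrite -[X in _ --> X]add0r -[X in X + _](scale0r v).
    by apply: cvgD; [apply: cvgZr_tmp; exact: cvg_id|exact: cvg_cst].
  have := c _ FG; rewrite !nbhs_simpl /= => K.
  by apply: filterS K => h /= ->.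
have E : h^-1 *: ((F \o shift x) (h *: v) - F x) @[h --> 0^'] =
         h^-1 *: ((G \o shift x) (h *: v) - G x) @[h --> 0^'].
  apply/seteqP; split; apply: near_eq_cvg => //.
  by near=> h; apply/esym; near: h.
by split; rewrite /derivable /derive E.
Unshelve. all: by end_near. Qed.

Lemma iter_partial_lin U (c : R) F G s x : open U ->
  smooth_on U F -> smooth_on U G -> U x ->
  iter_partial s (fun y => c * F y + G y) x =
  c * iter_partial s F x + iter_partial s G x.
Proof.
move=> oU sF sG; elim: s x => //= j s IH x Ux.
have H : \forall y \near x, iter_partial s (fun y => c * F y + G y) y =
  ((c \*: iter_partial s F) + iter_partial s G) y.
  by near=> y; apply: IH; near: y; exact: open_nbhs_nbhs.
have dF := (sF s x Ux).2 j; have dG := (sG s x Ux).2 j.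
rewrite (near_eq_derive _ H).2 deriveD ?deriveZ //; exact: derivableZ.
Unshelve. all: by end_near. Qed.

Lemma smooth_on_lin U (c : R) F G : open U ->
  smooth_on U F -> smooth_on U G -> smooth_on U (fun y => c * F y + G y).
Proof.
move=> oU sF sG s x Ux.
have H : \forall y \near x, ((c \*: iter_partial s F) + iter_partial s G) y =
  iter_partial s (fun y => c * F y + G y) y.
  near=> y; rewrite (iter_partial_lin _ _ oU)//; near: y.
  exact: open_nbhs_nbhs.
split=> [|j].
  rewrite /prop_for /continuous_at (iter_partial_lin _ _ oU)//.
  apply: cvg_trans (near_eq_cvg H) _.
  by apply: cvgD; [apply: cvgZl_tmp|]; [exact: (sF s x Ux).1|exact: (sG s x Ux).1].
apply: (near_eq_derive _ H).1; apply: derivableD; last exact: (sG s x Ux).2.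
by apply: derivableZ; exact: (sF s x Ux).2.
Unshelve. all: by end_near. Qed.

End smooth_Rn.

(* Iterated integral; by Tonelli it is the n-dimensional Lebesgue integral of *)
(* a nonnegative Borel function.                                              *)
Fixpoint lebesgue_integral_Rn {R : realType} (n : nat) :
    ('rV[R]_n -> \bar R) -> \bar R :=
  match n with
  | 0 => fun F => F 0
  | m.+1 => fun F => (\int[@lebesgue_measure R]_t
      lebesgue_integral_Rn (fun y : 'rV[R]_m => F (row_mx (t%:M : 'M[R]_1) y)))%E
  end.

(* Only the values of chart_map on chart_dom, and of chart_inv on the image   *)
(* of chart_dom, are meaningful.                                              *)
Record chart (R : realType) (n : nat) (M : topologicalType) := Chart {
  chart_dom : set M ;
  chart_map :> M -> 'rV[R]_n ;
  chart_inv : 'rV[R]_n -> M ;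
  chart_dom_open : open chart_dom ;
  chart_img_open : open (chart_map @` chart_dom) ;
  chart_map_continuous : {within chart_dom, continuous chart_map} ;
  chart_inv_continuous :
    {within chart_map @` chart_dom, continuous chart_inv} ;
  chart_mapK : {in chart_dom, cancel chart_map chart_inv} }.

Definition chart_img R n M (c : chart R n M) : set 'rV[R]_n :=
  c @` chart_dom c.

Definition overlap R n M (c d : chart R n M) : set 'rV[R]_n :=
  c @` (chart_dom c `&` chart_dom d).

Definition transition R n M (c d : chart R n M) : 'rV[R]_n -> 'rV[R]_n :=
  d \o chart_inv c.

(* The orientation is given by an atlas whose transition maps have positive  *)
(* Jacobian determinant. The metric is given by its Gram matrices in the      *)
(* charts; with row vectors, 'J F y sends v to v *m 'J F y, i.e. its (k, l)   *)
(* entry is the k-th partial derivative of the l-th component of F, hence the *)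
(* form J *m g *m J^T of the change of coordinates of the metric.             *)
Record oriented_riemannian_manifold (R : realType) (n : nat) := Manifold {
  carrier :> ptopologicalType ;
  manifold_hausdorff : hausdorff_space carrier ;
  manifold_second_countable : @second_countable carrier ;
  chart_index : choiceType ;
  atlas : chart_index -> chart R n carrier ;
  atlas_cover : forall p, exists i, chart_dom (atlas i) p ;
  transition_smooth : forall i j k, smooth_on (overlap (atlas i) (atlas j))
    (fun y => transition (atlas i) (atlas j) y 0 k) ;
  transition_oriented : forall i j y, overlap (atlas i) (atlas j) y ->
    0 < \det ('J (transition (atlas i) (atlas j)) y) ;
  metric : chart_index -> 'rV[R]_n -> 'M[R]_n ;
  metric_smooth : forall i k l,
    smooth_on (chart_img (atlas i)) (fun y => metric i y k l) ;
  metric_sym : forall i y, chart_img (atlas i) y -> (metric i y)^T = metric i y ;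
  metric_pos : forall i y (v : 'rV[R]_n), chart_img (atlas i) y -> v != 0 ->
    0 < (v *m metric i y *m v^T) 0 0 ;
  metric_transition : forall i j y, overlap (atlas i) (atlas j) y ->
    let J := 'J (transition (atlas i) (atlas j)) y in
    metric i y = J *m metric j (transition (atlas i) (atlas j) y) *m J^T }.

Section smooth_functions.
Context {R : realType} {n : nat} (M : oriented_riemannian_manifold R n).

Definition local_Re (f : M -> R[i]^o) (i : chart_index M) (y : 'rV[R]_n) : R :=
  complex.Re (f (chart_inv (atlas i) y)).

Definition local_Im (f : M -> R[i]^o) (i : chart_index M) (y : 'rV[R]_n) : R :=
  complex.Im (f (chart_inv (atlas i) y)).

(* Functions are complex-valued. *)
Definition smooth : {pred M -> R[i]^o} := mem [set f | forall i,
  smooth_on (chart_img (atlas i)) (local_Re f i) /\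
  smooth_on (chart_img (atlas i)) (local_Im f i)].

Lemma smooth_submod_closed : submod_closed smooth.
Proof.
have oI (i : chart_index M) : open (chart_img (atlas i)).
  exact: chart_img_open.
have s0 U : smooth_on U (fun=> 0 : R).
  move=> s x _; have -> : iter_partial s (fun=> 0 : R) = fun=> 0 : R.
    by elim: s => //= j s ->; apply/funext => y; exact: derive_cst.
  by split=> [|j]; [exact: cst_continuous|exact: derivable_cst].
split=> [|a f g /set_mem sf /set_mem sg]; apply/mem_set => i; first by [].
have [[fr fi] [gr gi]] := (sf i, sg i).
case: a => b c.
have E p : ((b +i* c)%C *: f + g) p = ((b +i* c)%C * f p + g p : R[i]) by [].
split.
  have -> : local_Re ((b +i* c)%C *: f + g) i = fun y => - c * local_Im f i y +
      (b * local_Re f i y + local_Re g i y).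
    apply/funext => y; rewrite /local_Re /local_Im /=.
    by rewrite E; case: (f _) => ? ?; case: (g _) => ? ? /=; ring.
  by apply: smooth_on_lin => //; exact: smooth_on_lin.
have -> : local_Im ((b +i* c)%C *: f + g) i = fun y => c * local_Re f i y +
    (b * local_Im f i y + local_Im g i y).
  apply/funext => y; rewrite /local_Re /local_Im /=.
  by rewrite E; case: (f _) => ? ?; case: (g _) => ? ? /=; ring.
by apply: smooth_on_lin => //; exact: smooth_on_lin.
Qed.

HB.instance Definition _ := GRing.isSubmodClosed.Build _ _ smooth
  smooth_submod_closed.

Record smooth_fun := SmoothFun {
  smooth_val :> M -> R[i]^o ;
  smooth_valP : smooth_val \in smooth }.

HB.instance Definition _ := [isSub for smooth_val].
HB.instance Definition _ := [Choice of smooth_fun by <:].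
HB.instance Definition _ := [SubChoice_isSubLmodule of smooth_fun by <:].

(* The topology of C^oo(M) is that of uniform convergence of every partial    *)
(* derivative, in every chart, on every compact subset of the chart: a jet    *)
(* collects the partial derivatives, indexed by (chart, multi-index, point).  *)
Definition jet (f : smooth_fun)
    (p : chart_index M * seq 'I_n * 'rV[R]_n) : R[i]^o :=
  (iter_partial p.1.2 (local_Re f p.1.1) p.2 +i*
   iter_partial p.1.2 (local_Im f p.1.1) p.2)%C.

Definition jet_compacts : set (set (chart_index M * seq 'I_n * 'rV[R]_n)) :=
  [set A | exists i s (K : set 'rV[R]_n),
    [/\ compact K, K `<=` chart_img (atlas i) &
        A = [set p | p.1 = (i, s) /\ K p.2]]].

HB.instance Definition _ := Uniform.copy smooth_fun
  (initial_topology (jet : smooth_fun -> {family jet_compacts, _ -> _})).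

End smooth_functions.

Definition von_neumann_bounded (K : numFieldType) (E : preTopologicalLmodType K)
    (B : set E) : Prop :=
  forall U : set E, nbhs 0 U -> exists2 r : K, 0 < r &
    forall a : K, r <= `|a| -> B `<=` [set a *: x | x in U].

Notation borel M := (g_sigma_algebraType (@open M)).

Section distributions.
Context {R : realType} {n : nat} (M : oriented_riemannian_manifold R n).

Definition distr : {pred smooth_fun M -> R[i]^o} := mem
  [set u : smooth_fun M -> R[i]^o | linear u /\ continuous u].

Lemma distr_submod_closed : submod_closed distr.
Proof.
split=> [|a u v /set_mem[lu cu] /set_mem[lv cv]]; apply/mem_set.
  split=> [b f g|f]; first by rewrite scaler0 addr0.
  exact: cst_continuous.
split=> [b f g|f].
  have E h : (a *: u + v) h = a *: u h + v h by [].
  by rewrite !E lu lv !scalerDr !scalerA (mulrC a) -!addrA; congr (_ + _);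
    rewrite addrCA.
have cuf : u h @[h --> f] --> u f by exact: cu.
exact: cvgD (@cvgZl_tmp _ (R[i]^o) _ _ _ a _ _ cuf) (cv f).
Qed.

HB.instance Definition _ := GRing.isSubmodClosed.Build _ _ distr
  distr_submod_closed.

Record distrib := Distrib {
  distrib_val :> smooth_fun M -> R[i]^o ;
  distrib_valP : distrib_val \in distr }.

HB.instance Definition _ := [isSub for distrib_val].
HB.instance Definition _ := [Choice of distrib by <:].
HB.instance Definition _ := [SubChoice_isSubLmodule of distrib by <:].

(* Strong dual topology: uniform convergence on the bounded sets of C^oo(M).  *)
HB.instance Definition _ := Uniform.copy distrib (initial_topology
  (distrib_val : distrib ->
     {family @von_neumann_bounded _ (smooth_fun M), smooth_fun M -> R[i]^o})).

(* mu is the Borel measure with density sqrt(det g) in every chart, i.e. the  *)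
(* measure of the Riemannian volume form; this determines mu, as finitely or  *)
(* countably many charts cover M.                                             *)
Definition is_riemannian_volume (mu : {measure set (borel M) -> \bar R}) : Prop :=
  forall (i : chart_index M) (A : set (borel M)),
    measurable A -> A `<=` chart_dom (atlas i) ->
    mu A = lebesgue_integral_Rn (fun y =>
      (\1_(atlas i @` A) y * Num.sqrt (\det (metric i y)))%:E).

End distributions.

Section pairing.
Context {R : realType} {n : nat} {M : oriented_riemannian_manifold R n}.
Variable mu : {measure set (borel M) -> \bar R}.
Implicit Types (f g v w : smooth_fun M) (u T : distrib M).
Implicit Type P : distrib M -> distrib M.

Definition integral_C (h : M -> R[i]) : R[i] :=
  ((\int[mu]_x complex.Re (h x)) +i* (\int[mu]_x complex.Im (h x)))%C.

Definition pairing f g : R[i] := integral_C (fun x => f x * g x).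

(* T is the distribution identified with the function f. *)
Definition represents f T : Prop := forall g, T g = pairing f g.

Definition is_smooth_distrib T : Prop := exists f, represents f T.

(* P f = g, for P seen as an operator on C^oo(M). *)
Definition op_smooth P f g : Prop :=
  exists2 T, represents f T & represents g (P T).

Definition preserves_smooth P : Prop :=
  forall T, is_smooth_distrib T -> is_smooth_distrib (P T).

(* Graphs of the two transposes, tP v = w. On C^oo(M) (the dual of D'(M)), tP *)
(* is the transpose of P : D'(M) -> D'(M); on D'(M), it is the transpose of   *)
(* P : C^oo(M) -> C^oo(M).                                                    *)
Definition transpose_smooth P v w : Prop := forall u, P u v = u w.

Definition transpose_distrib P u (w : distrib M) : Prop :=
  forall f g, op_smooth P f g -> u g = w f.

Definition ker_transpose_smooth P : set (smooth_fun M) :=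
  [set v | transpose_smooth P v 0].

Definition ker_transpose_distrib P : set (distrib M) :=
  [set u | transpose_distrib P u 0].

Definition smooth_kernel_dense P : Prop :=
  ker_transpose_distrib P `<=`
  closure [set T | exists2 v, ker_transpose_smooth P v & represents v T].

Definition smooth_range P : set (smooth_fun M) :=
  [set g | exists f, op_smooth P f g].

Definition almost_globally_hypoelliptic P : Prop :=
  forall u, is_smooth_distrib (P u) ->
    exists2 T, is_smooth_distrib T & P T = P u.

Definition weakly_globally_solvable P : Prop :=
  forall f, (forall v, ker_transpose_smooth P v -> pairing f v = 0) ->
    exists u, represents f (P u).

End pairing.

(* Main.v *)
Require Import Defs.
From HB Require Import structures.
From mathcomp Require Import all_boot all_order all_algebra.
From mathcomp Require Import complex finmap ring lra.
From mathcomp Require Import all_classical all_reals all_analysis.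

Set Implicit Arguments.
Unset Strict Implicit.
Unset Printing Implicit Defensive.

Import Order.TTheory GRing.Theory Num.Theory.
Import numFieldNormedType.Exports.

Local Open Scope classical_set_scope.
Local Open Scope ring_scope.

(** The first claim is a density argument. Evaluation at a fixed smooth f is
    continuous on distributions for the strong topology, because the singleton
    {f} is a bounded set ([distrib_eval_continuous]). A distribution v in the
    kernel of tP is a limit of smooth elements w of that kernel, on which the
    evaluation at f is <w, f> = <f, w> = 0; hence v f = 0
    ([orthogonal_distrib_kernel]).

    The second claim is the classical description of a closed range by its
    annihilator. If f did not belong to the closed subspace P(C^oo(M)), the
    Hahn-Banach theorem would give a distribution u that vanishes on this
    subspace and not at f ([closed_submodule_separation]). Vanishing on the
    range means tP u = 0, so the first claim gives u f = 0, a contradiction.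
    Thus every f orthogonal to the smooth kernel of tP is P g for a smooth g
    ([smooth_range_orthogonal]), which is weak global solvability. If P u is a
    smooth f, then <f, v> = u (tP v) = 0 for every smooth v with tP v = 0, so
    the same smooth solution g gives almost global hypoellipticity.

    Three ingredients carry this. A minimal sublinear functional is linear, and
    Zorn's lemma provides one below any given sublinear functional
    ([hahn_banach]); this is turned into the separation of a point from a
    complex subspace by an absolutely convex set ([separation]). The topology
    of C^oo(M) is locally convex: the uniform conditions on jets over finite
    unions of compact sets of charts form a basis of neighbourhoods
    ([nbhs_jet_controlled]). Finally the range of P on smooth functions is a
    subspace only because the pairing is bilinear, which requires products of
    smooth functions to be integrable: they are bounded and continuous, and a
    compact manifold has finite volume ([finite_volume]). *)

(** * Sublinear functionals and the Hahn-Banach theorem *)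

Section hahn_banach.
Context {R : realType} {V : lmodType R}.
Implicit Types (s q : V -> R) (x y : V).

(** Homogeneity is only asked as an inequality for r > 0: applied to r^-1 as
    well, it gives equality, and r = 2, 1/2 force the value 0 at 0. *)
Definition sublinear s :=
  (forall x y, s (x + y) <= s x + s y) /\
  (forall (r : R) x, 0 < r -> s (r *: x) <= r * s x).

Lemma sublinear0 s : sublinear s -> s 0 = 0.
Proof.
move=> [_ sZ].
have := sZ 2 0 ltac:(lra); have := sZ 2^-1 0 ltac:(lra).
rewrite !scaler0; lra.
Qed.

Lemma sublinearZ s r x : sublinear s -> 0 <= r -> s (r *: x) = r * s x.
Proof.
move=> ss; rewrite le_eqVlt => /predU1P[<-|r0].
  by rewrite scale0r mul0r sublinear0.
apply/eqP; rewrite eq_le ss.2//=.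
have := ss.2 r^-1 (r *: x); rewrite invr_gt0 => /(_ r0).
by rewrite scalerA mulVf ?gt_eqF// scale1r ler_pdivlMl.
Qed.

Lemma sublinear_geN s x : sublinear s -> - s (- x) <= s x.
Proof.
move=> ss; have := ss.1 x (- x); rewrite subrr (sublinear0 ss); lra.
Qed.

(** The three sublinear functionals built below (lowering along a ray, infimum
    of a chain, gauge of a convex set modulo a subspace) are infima of families
    of sets of reals; this isolates what such a family must satisfy. *)
Lemma sublinear_inf (E : V -> set R) :
  (forall x, E x !=set0) -> (forall x, has_lbound (E x)) ->
  (forall x y a b, E x a -> E y b -> exists2 c, E (x + y) c & c <= a + b) ->
  (forall r x a, 0 < r -> E x a -> exists2 c, E (r *: x) c & c <= r * a) ->
  sublinear (fun x => inf (E x)).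
Proof.
move=> E0 Elb ED EZ; split=> [x y|r x r0].
  rewrite -lerBlDr; apply: lb_le_inf => // a xa.
  rewrite lerBlDr -lerBlDl; apply: lb_le_inf => // b yb; rewrite lerBlDl.
  have [c xyc cab] := ED _ _ _ _ xa yb.
  by apply: le_trans cab; exact: ge_inf.
rewrite -ler_pdivrMl//; apply: lb_le_inf => // a xa; rewrite ler_pdivrMl//.
have [c rxc ca] := EZ _ _ _ r0 xa.
by apply: le_trans ca; exact: ge_inf.
Qed.

(** The device that makes minimal sublinear functionals odd: [lower q y] is
    sublinear, lies below q (take t = 0), and its value at - y is at most
    - q y (take t = 1). *)
Definition lower q y x : R :=
  inf [set q (x + t *: y) - t * q y | t in [set t : R | 0 <= t]].

Lemma lower_lbound q y x : sublinear q ->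
  has_lbound [set q (x + t *: y) - t * q y | t in [set t : R | 0 <= t]].
Proof.
move=> sq; exists (- q (- x)) => _ [t /= t0 <-].
have := sublinearZ y sq t0; have := sq.1 (x + t *: y) (- x).
by rewrite addrAC subrr add0r; lra.
Qed.

Lemma lower_sublinear q y : sublinear q -> sublinear (lower q y).
Proof.
move=> sq; apply: sublinear_inf => [x|x|x z _ _ [t /= t0 <-] [u /= u0 <-]|].
- by exists (q (x + 0 *: y) - 0 * q y), 0 => /=.
- exact: lower_lbound.
- exists (q ((x + z) + (t + u) *: y) - (t + u) * q y).
    by exists (t + u) => //=; exact: addr_ge0.
  have := sq.1 (x + t *: y) (z + u *: y); rewrite addrACA -scalerDl; lra.
- move=> r x _ r0 [t /= t0 <-].
  exists (q (r *: x + (r * t) *: y) - r * t * q y).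
    by exists (r * t) => //=; rewrite mulr_ge0// ltW.
  by rewrite -scalerA -scalerDr mulrBr mulrA lerB// sq.2.
Qed.

Lemma lower_le q y x t : sublinear q -> 0 <= t ->
  lower q y x <= q (x + t *: y) - t * q y.
Proof. by move=> sq t0; apply: ge_inf; [exact: lower_lbound|exists t]. Qed.

Lemma lower_leq q y x : sublinear q -> lower q y x <= q x.
Proof.
move=> sq; have := lower_le y x sq (lexx 0).
by rewrite scale0r addr0 mul0r subr0.
Qed.

Lemma lowerN q y : sublinear q -> lower q y (- y) <= - q y.
Proof.
move=> sq; have := lower_le y (- y) sq ler01.
by rewrite scale1r addNr (sublinear0 sq) mul1r sub0r.
Qed.

(** Zorn's lemma for the reverse pointwise order. A chain has its pointwise
    infimum as a lower bound: the infimum is finite since any sublinear s <= q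
    satisfies s x >= - s (- x) >= - q (- x), and it is subadditive because two
    members of a chain can be replaced by the smaller one. *)
Lemma minimal_sublinear q : sublinear q ->
  exists s, [/\ sublinear s, forall x, s x <= q x &
    forall s', sublinear s' -> (forall x, s' x <= s x) -> s' = s].
Proof.
move=> sq.
pose T := {s | sublinear s /\ forall x, s x <= q x}.
pose le (s t : T) := `[< forall x, sval t x <= sval s x >].
have [||||[s [ss sleq]] smin] := @Zorn T le.
- by move=> s; apply/asboolP.
- move=> r s t /asboolP rs /asboolP st; apply/asboolP => x.
  exact: le_trans (st x) (rs x).
- move=> [s ps] [t pt] /asboolP /= st /asboolP /= ts.
  have E : s = t by apply/funext => x; apply/eqP; rewrite eq_le st ts.
  by subst t; congr exist; exact: Prop_irrelevance.
- move=> A Atot; have [[s0 As0]|A0] := pselect (exists t, A t); last first.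
    have qq x : q x <= q x by [].
    pose t0 : T := exist _ q (conj sq qq).
    exists t0 => s As.
    by exfalso; apply: A0; exists s.
  pose E x := [set sval s x | s in A].
  have Elb x : has_lbound (E x).
    exists (- q (- x)) => _ [s As <-]; case: s {As} => s [/= ss sleq].
    by apply: le_trans (sublinear_geN x ss); rewrite lerN2.
  have sE : sublinear (fun x => inf (E x)).
    apply: sublinear_inf => [x|//|x y _ _ [s As <-] [t At <-]|].
    + by exists (sval s0 x), s0.
    + have [/asboolP st|/asboolP ts] := Atot _ _ As At.
        exists (sval t (x + y)); first by exists t.
        by apply: le_trans ((svalP t).1.1 x y) _; rewrite lerD2r.
      exists (sval s (x + y)); first by exists s.
      by apply: le_trans ((svalP s).1.1 x y) _; rewrite lerD2l.
    + move=> r x _ r0 [s As <-]; exists (sval s (r *: x)); first by exists s.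
      exact: (svalP s).1.2.
  have Eq x : inf (E x) <= q x.
    apply: le_trans ((svalP s0).2 x).
    by apply: ge_inf => //; exists s0.
  pose t0 : T := exist _ (fun x => inf (E x)) (conj sE Eq).
  exists t0 => s As; apply/asboolP => x /=.
  by apply: ge_inf => //; exists s.
- exists s; split=> // s' ss' s's.
  have s'q x : s' x <= q x by exact: le_trans (s's x) (sleq x).
  pose t' : T := exist _ s' (conj ss' s'q).
  by have /(congr1 sval) : t' = exist _ s (conj ss sleq)
    by apply: smin; apply/asboolP.
Qed.

(** A minimal s below [lower q x0] is odd, since [lower s x] = s for every x;
    an odd sublinear functional is linear. Starting from [lower q x0] rather
    than from q forces s (- x0) <= - q x0, i.e. s x0 >= q x0. *)
Theorem hahn_banach q x0 : sublinear q ->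
  exists2 phi : {linear V -> R^o}, (forall x, phi x <= q x) & phi x0 = q x0.
Proof.
move=> sq.
have [s [ss sle smin]] := minimal_sublinear (lower_sublinear x0 sq).
have sN x : s (- x) = - s x.
  apply/eqP; rewrite eq_le; apply/andP; split; last first.
    by have := sublinear_geN x ss; lra.
  have E := smin _ (lower_sublinear x ss) (fun y => lower_leq x y ss).
  by have := lowerN x ss; rewrite E.
have sD x y : s (x + y) = s x + s y.
  apply/eqP; rewrite eq_le ss.1 /=.
  have := ss.1 (x + y) (- y); rewrite addrK sN; lra.
have sZ r x : s (r *: x) = r * s x.
  have [r0|/ltW r0] := leP 0 r; first exact: sublinearZ.
  rewrite -[r]opprK scaleNr sN mulNr sublinearZ ?oppr_ge0//.
have lin_s : linear (s : V -> R^o) by move=> r x y; rewrite sD sZ.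
pose L := GRing.isLinear.Build _ _ _ _ (s : V -> R^o) lin_s.
pose phi : {linear V -> R^o} := HB.pack (s : V -> R^o) L.
have sq' x : phi x <= q x by exact: le_trans (sle x) (lower_leq _ _ sq).
exists phi => //; apply/eqP; rewrite eq_le sq' /=.
have := le_trans (sle (- x0)) (lowerN x0 sq).
by rewrite sN lerN2.
Qed.

End hahn_banach.

(** * Separation from a complex subspace *)

(** The underlying real space of a complex space; a distinct name is needed to
    carry a second scalar multiplication. *)
Definition real_scalars (R : realType) (V : lmodType R[i]) : Type := V.

Section real_scalars.
Context {R : realType} {V : lmodType R[i]}.

HB.instance Definition _ := GRing.Zmodule.on (real_scalars V).

Let scale (r : R) (v : real_scalars V) : real_scalars V :=
  (real_complex R r) *: (v : V).

Let scaleA a b v : scale a (scale b v) = scale (a * b) v.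
Proof. by rewrite /scale scalerA rmorphM. Qed.

Let scale1 : left_id 1 scale.
Proof. by move=> v; rewrite /scale rmorph1 scale1r. Qed.

Let scaleDr : right_distributive scale +%R.
Proof. by move=> a u v; rewrite /scale scalerDr. Qed.

Let scaleDl v : {morph scale^~ v : a b / a + b}.
Proof. by move=> a b; rewrite /scale rmorphD scalerDl. Qed.

HB.instance Definition _ := GRing.Zmodule_isLmodule.Build R (real_scalars V)
  scaleA scale1 scaleDr scaleDl.

Lemma real_scalarsE (r : R) (v : real_scalars V) :
  r *: v = (real_complex R r *: (v : V) : V).
Proof. by []. Qed.

End real_scalars.

Section separation.
Context {R : realType} {V : lmodType R[i]}.
Local Notation C := R[i].
Implicit Types (A F : set V) (v w : V).

Definition absorbing A := forall v, exists2 r : R, 0 < r &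
  exists2 b, A b & v = r%:C%C *: b.

Definition absolutely_convex A := forall (c d : C) a b, A a -> A b ->
  `|c| + `|d| <= 1 -> A (c *: a + d *: b).

(** The complex functional with real part phi is determined by complex
    linearity: its imaginary part is v |-> - phi (i v). *)
Definition complexify (phi : V -> R) (v : V) : C :=
  (phi v +i* - phi ('i%C *: v))%C.

Lemma complexify_linear (phi : {linear real_scalars V -> R^o}) :
  linear (complexify phi : V -> C^o).
Proof.
have phiD v w : phi (v + w : V) = phi v + phi w by exact: raddfD.
have phiZ (r : R) v : phi (r%:C%C *: v) = r * phi v.
  by rewrite -real_scalarsE linearZ.
have phic (c : C) v : phi (c *: v) =
    complex.Re c * phi v + complex.Im c * phi ('i%C *: v).
  case: c => a b /=; have -> : (a +i* b = a%:C + b%:C * 'i)%C.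
    by apply/eqP; rewrite eq_complex /=; simpc.
  by rewrite scalerDl -scalerA phiD !phiZ.
move=> c v w; rewrite /complexify scalerDr !phiD scalerA.
rewrite (phic c) (phic ('i%C * c)).
case: c => a b; apply/eqP; rewrite eq_complex /=.
by apply/andP; split; apply/eqP => /=; ring.
Qed.

Lemma normc_real (x : R) : `|x%:C%C| = `|x|%:C%C.
Proof. by rewrite normc_def /= expr0n addr0 sqrtr_sqr. Qed.

Lemma normc_pos (x : R) : 0 < x -> `|x%:C%C| = x%:C%C.
Proof. by move=> x0; rewrite normc_real gtr0_norm. Qed.

Lemma normc_i : `|'i%C| = 1 :> C.
Proof. by rewrite normc_def /= expr0n expr1n add0r sqrtr1. Qed.

Lemma le_normc_ReIm (z : C) :
  `|z| <= (`|complex.Re z| + `|complex.Im z|)%:C%C.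
Proof.
rewrite {1}[z]complexE rmorphD /=; apply: le_trans (ler_normD _ _) _.
by rewrite normrM normc_i mul1r !normc_real.
Qed.

(** Hahn-Banach is applied to the gauge of A modulo F,
    q v = inf {t > 0 | v is in t A + F}. It vanishes on F, is at most 1 on A,
    and is at least 1 at v0 because v0 + A misses F. A real linear phi <= q
    with phi v0 = q v0 then vanishes on F and is bounded by 1 on A; as F and A
    are stable under multiplication by i, so does its complexification up to
    the factor 2. *)
Theorem separation A F v0 :
  absorbing A -> absolutely_convex A ->
  F 0 -> (forall c v w, F v -> F w -> F (c *: v + w)) ->
  (forall a, A a -> ~ F (v0 + a)) ->
  exists u : V -> C^o, [/\ linear u, forall v, F v -> u v = 0, u v0 != 0 &
    forall a, A a -> `|u a| <= 2].
Proof.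
move=> absA acA F0 Flin Av0F.
have A0 : A 0.
  have [r _ [b Ab _]] := absA 0.
  by have := acA 0 0 _ _ Ab Ab; rewrite !scale0r addr0 normr0 addr0; apply.
have FD v w : F v -> F w -> F (v + w).
  by move=> Fv Fw; have := Flin 1 _ _ Fv Fw; rewrite scale1r.
have FZ c v : F v -> F (c *: v).
  by move=> Fv; have := Flin c _ _ Fv F0; rewrite addr0.
pose E (v : real_scalars V) : set R :=
  [set t | 0 < t /\ exists2 a, A a & F ((v : V) - t%:C%C *: a)].
pose q v := inf (E v).
have Elb v : has_lbound (E v) by exists 0 => t [/ltW].
have qle v t : E v t -> q v <= t by exact: ge_inf.
have sq : @sublinear R (real_scalars V) q.
  apply: sublinear_inf => //.
  - move=> v; have [r r0 [a Aa ->]] := absA v.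
    by exists r; split=> //; exists a => //; rewrite subrr.
  - move=> v w s t [s0 [a Aa Fa]] [t0 [b Ab Fb]]; exists (s + t) => //.
    have st0 : s + t != 0 by rewrite gt_eqF// addr_gt0.
    split; first exact: addr_gt0.
    exists ((s / (s + t))%:C%C *: a + (t / (s + t))%:C%C *: b).
      apply: acA => //; rewrite !normc_real -rmorphD.
      rewrite -(rmorph1 (real_complex R)).
      have [s0' t0'] := (ltW s0, ltW t0).
      by rewrite lecR !ger0_norm ?divr_ge0 ?addr_ge0// -mulrDl divff.
    rewrite scalerDr !scalerA -!rmorphM !mulrA ![(s + t) * _]mulrC !mulfK//.
    by rewrite opprD addrACA; exact: FD.
  - move=> r v t r0 [t0 [a Aa Fa]]; exists (r * t) => //.
    split; first exact: mulr_gt0.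
    exists a => //; rewrite real_scalarsE rmorphM -scalerA -scalerBr.
    exact: FZ.
have qv0 : 1 <= q v0.
  apply: lb_le_inf.
    have [r r0 [a Aa ->]] := absA v0.
    by exists r; split=> //; exists a => //; rewrite subrr.
  move=> t [t0 [a Aa Fa]]; rewrite leNgt; apply/negP => t1.
  apply: (Av0F ((- t)%:C%C *: a)); last by rewrite rmorphN scaleNr.
  have := acA (- t)%:C%C 0 _ _ Aa Aa; rewrite scale0r addr0; apply.
  by rewrite normr0 addr0 normc_real normrN lecR ger0_norm ?ltW.
have [phi phiq phiv0] := hahn_banach (v0 : real_scalars V) sq.
have phi_le a : A a -> `|phi a| <= 1.
  have phi_le1 b : A b -> phi b <= 1.
    move=> Ab; apply: le_trans (phiq _) _; apply: qle; split=> //.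
    by exists b => //; rewrite scale1r subrr.
  move=> Aa; rewrite ler_norml phi_le1// andbT lerNl -linearN phi_le1//.
  have := acA (-1) 0 _ _ Aa Aa; rewrite scale0r addr0 scaleN1r; apply.
  by rewrite normrN1 normr0 addr0.
have phiF v : F v -> phi v = 0.
  have phi_le0 w : F w -> phi w <= 0.
    move=> Fw; apply/ler_addgt0Pl => e e0; rewrite addr0.
    apply: le_trans (phiq _) _; apply: qle; split=> //.
    by exists 0 => //; rewrite scaler0 subr0.
  move=> Fv; apply/eqP; rewrite eq_le phi_le0//= -oppr_le0 -linearN phi_le0//.
  by have := FZ (-1) _ Fv; rewrite scaleN1r.
exists (complexify phi); split.
- exact: complexify_linear.
- by move=> v Fv; rewrite /complexify !phiF ?oppr0//; exact: FZ.
- rewrite eq_complex /= negb_and phiv0 gt_eqF//.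
  exact: lt_le_trans qv0.
- move=> a Aa; apply: le_trans (le_normc_ReIm _) _ => /=; rewrite normrN.
  have -> : (2 : C) = (1 + 1)%:C%C by rewrite rmorphD rmorph1.
  rewrite lecR lerD ?phi_le//.
  have := acA 'i%C 0 _ _ Aa Aa; rewrite scale0r addr0; apply.
  by rewrite normr0 addr0 normc_i.
Qed.

End separation.

(** * Local convexity of the space of smooth functions *)

Lemma compact_continuous_bounded (R : realType) (T : topologicalType)
    (F : T -> R) (K : set T) :
  compact K -> (forall x, K x -> {for x, continuous F}) ->
  exists c, forall x, K x -> `|F x| <= c.
Proof.
move=> cK cF.
have /compact_bounded[c [_ Fc]] : compact (F @` K).
  apply: continuous_compact => //; apply: continuous_in_subspaceT => x.
  by move=> /set_mem; exact: cF.
exists (c + 1) => x Kx; apply: (Fc (c + 1)); last by exists x.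
by rewrite ltrDl.
Qed.

Section jets.
Context {R : realType} {n : nat} {M : oriented_riemannian_manifold R n}.
Local Notation C := R[i].
Local Notation jet_point := (chart_index M * seq 'I_n * 'rV[R]_n)%type.
Local Notation jet_space := {family @jet_compacts R n M, jet_point -> C^o}.
Implicit Types (f g : smooth_fun M) (q : jet_point) (S : set jet_point).

Lemma smooth_fun_on f i :
  smooth_on (chart_img (atlas i)) (local_Re f i) /\
  smooth_on (chart_img (atlas i)) (local_Im f i).
Proof. by have /set_mem := smooth_valP f; apply. Qed.

Lemma jet_linear (c : C) f g q : chart_img (atlas q.1.1) q.2 ->
  jet (c *: f + g) q = c * jet f q + jet g q.
Proof.
case: q => -[i s] y /= iy; rewrite /jet /=.
have [[fr fi] [gr gi]] := (smooth_fun_on f i, smooth_fun_on g i).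
have oI : open (chart_img (atlas i)) by exact: chart_img_open.
case: c => a b.
have E p : (((a +i* b)%C *: f + g : smooth_fun M) p) =
    ((a +i* b)%C * f p + g p : C) by [].
have -> : local_Re ((a +i* b)%C *: f + g : smooth_fun M) i =
    fun y => - b * local_Im f i y + (a * local_Re f i y + local_Re g i y).
  apply/funext => z; rewrite /local_Re /local_Im E.
  by case: (f _) => ? ?; case: (g _) => ? ? /=; ring.
have -> : local_Im ((a +i* b)%C *: f + g : smooth_fun M) i =
    fun y => b * local_Re f i y + (a * local_Im f i y + local_Im g i y).
  apply/funext => z; rewrite /local_Re /local_Im E.
  by case: (f _) => ? ?; case: (g _) => ? ? /=; ring.
rewrite !(iter_partial_lin _ _ oI) //; try exact: smooth_on_lin.
by apply/eqP; rewrite eq_complex /=; apply/andP; split; apply/eqP; ring.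
Qed.

(** The index sets on which uniform conditions on jets behave like a continuous
    seminorm: jets are linear on S, bounded on S, and close on S for nearby
    functions. Unlike [jet_compacts], this class is closed under finite unions,
    so that one set S and one radius suffice to describe a neighbourhood. *)
Definition jet_controlled S :=
  [/\ forall q, S q -> chart_img (atlas q.1.1) q.2,
      forall f, exists2 c : R, 0 < c & forall q, S q -> `|jet f q| <= c%:C%C &
      forall f (e : R), 0 < e ->
        \forall g \near f, forall q, S q -> `|jet f q - jet g q| < e%:C%C].

Lemma jet_controlled0 : jet_controlled set0.
Proof. by split=> // f; [exists 1|move=> e _; exact: filterE]. Qed.

Lemma jet_controlledU S S' :
  jet_controlled S -> jet_controlled S' -> jet_controlled (S `|` S').
Proof.
move=> [Si Sb Sn] [S'i S'b S'n]; split=> [q|f|f e e0].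
- by case=> [/Si|/S'i].
- have [[c c0 fc] [d d0 fd]] := (Sb f, S'b f).
  exists (c + d); first exact: addr_gt0.
  move=> q [/fc|/fd] /le_trans; apply; rewrite lecR.
    by rewrite lerDl ltW.
  by rewrite lerDr ltW.
- by apply: filterS2 (Sn f e e0) (S'n f e e0) => g Sg S'g q [/Sg|/S'g].
Qed.

Lemma jet_controlled_compact S : jet_compacts S -> jet_controlled S.
Proof.
move=> JS; have [i [s [K [cK Ki SE]]]] := JS.
have Si q : S q -> chart_img (atlas q.1.1) q.2.
  by rewrite SE => -[Eq /Ki]; rewrite Eq.
split=> // [f|f e e0].
  have [fr fi] := smooth_fun_on f i.
  have [c fc] := compact_continuous_bounded cK
    (fun x Kx => (fr s x (Ki x Kx)).1).
  have [d fd] := compact_continuous_bounded cK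
    (fun x Kx => (fi s x (Ki x Kx)).1).
  exists (`|c| + `|d| + 1); first by rewrite ltr_wpDl// addr_ge0.
  rewrite SE => -[q y] /= [-> Ky]; apply: le_trans (le_normc_ReIm _) _.
  rewrite lecR /= ler_wpDr// lerD//.
    exact: le_trans (fc y Ky) (ler_norm _).
  exact: le_trans (fd y Ky) (ler_norm _).
pose E : set (C^o * C^o) := [set z | ball z.1 (e%:C%C : C) z.2].
have entE : entourage E.
  by rewrite -entourage_ballE; exists (e%:C%C) => //=; rewrite ltcR.
have := @fam_nbhs _ _ _ _ _ (jet f : jet_space) entE JS.
move=> /(initial_continuous (f := @jet R n M : smooth_fun M -> jet_space)) H.
by rewrite nbhs_simpl /= in H; apply: (filterS _ H) => g gE q /gE.
Qed.

(** The sets {g | |jet f - jet g| < e on S} generate a filter; by the definition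
    of the topology of C^oo(M) this filter converges to f, i.e. every
    neighbourhood of f contains such a set. *)
Lemma nbhs_jet_controlled f (U : set (smooth_fun M)) : nbhs f U ->
  exists S, jet_controlled S /\ exists2 e : R, 0 < e &
    [set g | forall q, S q -> `|jet f q - jet g q| < e%:C%C] `<=` U.
Proof.
pose D := [set p : set jet_point * R | jet_controlled p.1 /\ 0 < p.2].
pose B (p : set jet_point * R) : set (smooth_fun M) :=
  [set g | forall q, p.1 q -> `|jet f q - jet g q| < p.2%:C%C].
pose G := filter_from D B.
have FG : Filter G.
  apply: filter_from_filter; first exists (set0, 1).
    by split => //; exact: jet_controlled0.
  move=> [S e] [S' e'] [/= cS e0] [/= cS' e'0].
  exists (S `|` S', Num.min e e'); first split=> /=.
  - exact: jet_controlledU.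
  - by rewrite lt_min e0.
  - move=> g gB; split=> q /= Sq.
      by apply: lt_le_trans (gB q (or_introl Sq)) _; rewrite lecR ge_min lexx.
    apply: lt_le_trans (gB q (or_intror Sq)) _.
    by rewrite lecR ge_min lexx orbT.
have cvG : (jet g : jet_space) @[g --> G] -->
    (jet f : jet_space).
  apply/fam_cvgP => S JS W /uniform_nbhs[E [entE EW]].
  move: entE; rewrite -entourage_ballE => -[e /= e0 eE].
  have [ee0 eRe] : 0 < (complex.Re e) /\ (complex.Re e)%:C%C = e.
    by move: e0; case: (e) => a b; rewrite /= ltcE /= => /andP[/eqP -> ->].
  exists (S, complex.Re e); first by split=> //; exact: jet_controlled_compact.
  move=> g /= gB; apply: EW => q Sq; apply: eE; rewrite /ball_/= /ball /=.
  by have := gB _ Sq; rewrite eRe.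
move=> [_ [[W oW <-] Wf WU]].
have /cvG [p [pS pe] pW] : nbhs (jet f : jet_space) W.
  exact: open_nbhs_nbhs.
exists p.1; split=> //; exists p.2 => // g gB.
exact/WU/pW.
Qed.

End jets.

(** * Distributions: separation and evaluation *)

Lemma continuous_complexP (R : realType) (T : topologicalType)
    (F : T -> R[i]^o) :
  (forall x (e : R), 0 < e -> \forall y \near x, `|F x - F y| < e%:C%C) ->
  continuous F.
Proof.
move=> FP x; apply/(@cvgrPdist_lt _ _ _ _ (nbhs_filter x)) => e.
by case: e => e ?; rewrite ltcE /= => /andP[/eqP -> e0]; exact: FP.
Qed.

Section smooth_fun_tvs.
Context {R : realType} {n : nat} {M : oriented_riemannian_manifold R n}.
Local Notation C := R[i].
Local Notation jet_point := (chart_index M * seq 'I_n * 'rV[R]_n)%type.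
Implicit Types (f g : smooth_fun M) (q : jet_point) (S : set jet_point).

Definition jet_ball S (e : R) : set (smooth_fun M) :=
  [set g | forall q, S q -> `|jet g q| < e%:C%C].

Lemma jet0 q : chart_img (atlas q.1.1) q.2 -> jet (0 : smooth_fun M) q = 0.
Proof.
move=> iq; have := jet_linear 1 (0 : smooth_fun M) 0 iq.
rewrite scaler0 addr0 mul1r => /eqP.
by rewrite -subr_eq0 opprD addNKr oppr_eq0 => /eqP.
Qed.

Lemma jetZ (c : C) f q : chart_img (atlas q.1.1) q.2 ->
  jet (c *: f) q = c * jet f q.
Proof. by move=> iq; rewrite -[c *: f]addr0 jet_linear// jet0// addr0. Qed.

Lemma jetB f g q : chart_img (atlas q.1.1) q.2 ->
  jet (f - g) q = jet f q - jet g q.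
Proof. by move=> iq; rewrite addrC -scaleN1r jet_linear// mulN1r addrC. Qed.

Lemma jet_ball_absorbing S e : jet_controlled S -> 0 < e ->
  absorbing (jet_ball S e).
Proof.
move=> [Si Sb _] e0 f; have [c c0 fc] := Sb f.
have r0 : 0 < 2 * c / e by rewrite divr_gt0// mulr_gt0.
exists (2 * c / e) => //; exists ((2 * c / e)^-1%:C%C *: f); last first.
  by rewrite scalerA -rmorphM mulfV ?gt_eqF// rmorph1 scale1r.
move=> q Sq; rewrite jetZ; last exact: Si.
rewrite normrM normc_pos ?invr_gt0//.
have -> : e%:C%C = (2 * c / e)^-1%:C%C * (2 * c)%:C%C.
  by rewrite -rmorphM; congr (_%:C)%C; field; rewrite !gt_eqF.
rewrite ltr_pM2l; last by rewrite ltcR invr_gt0.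
by apply: le_lt_trans (fc q Sq) _; rewrite ltcR ltr_pMl// ltr1n.
Qed.

Lemma jet_ball_absolutely_convex S e : jet_controlled S -> 0 < e ->
  absolutely_convex (jet_ball S e).
Proof.
move=> [Si _ _] e0 c d f g fe ge cd q Sq; have iq := Si q Sq.
rewrite jet_linear// jetZ//; apply: le_lt_trans (ler_normD _ _) _.
rewrite !normrM.
(* The bound is strict, so that one of the coefficients has to be nonzero. *)
have [c0|c0] := eqVneq c 0.
  rewrite c0 normr0 mul0r add0r; rewrite c0 normr0 add0r in cd.
  apply: le_lt_trans (ge q Sq); exact: ler_piMl.
have : `|c| * `|jet f q| + `|d| * `|jet g q| < (`|c| + `|d|) * e%:C%C.
  rewrite mulrDl ltr_leD//; first by rewrite ltr_pM2l ?normr_gt0// fe.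
  by rewrite ler_wpM2l// ltW// ge.
by move=> /lt_le_trans; apply; rewrite ler_piMl// lecR ltW.
Qed.

(** If |jet (f - g)| < e r / 4 on S then (4 / r) (f - g) is in the ball, so
    |u f - u g| <= r / 2. *)
Lemma jet_ball_bounded_continuous S e (u : smooth_fun M -> C^o) :
  jet_controlled S -> 0 < e -> linear u ->
  (forall g, jet_ball S e g -> `|u g| <= 2) -> continuous u.
Proof.
move=> [Si _ Sn] e0 lu ub ; apply: continuous_complexP => f r r0.
have re0 : 0 < e * (r / 4) by rewrite mulr_gt0// divr_gt0.
apply: filterS (Sn f _ re0) => g fg.
have : jet_ball S e ((4 / r)%:C%C *: (f - g)).
  move=> q Sq; have iq := Si q Sq.
  rewrite jetZ// jetB// normrM normc_pos ?divr_gt0//.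
  have -> : e%:C%C = (4 / r)%:C%C * (e * (r / 4))%:C%C.
    by rewrite -rmorphM; congr (_%:C)%C; field; rewrite gt_eqF.
  by rewrite ltr_pM2l ?fg// ltcR divr_gt0.
move=> /ub.
have u0 : u 0 = 0.
  by have := lu (-1) 0 0; rewrite scaler0 addr0 scaleN1r addNr.
have -> : u ((4 / r)%:C%C *: (f - g)) = (4 / r)%:C%C * (u f - u g).
  rewrite -[in LHS](addr0 (_ *: (f - g))) lu u0 addr0; congr (_ * _).
  by rewrite addrC -scaleN1r lu scaleN1r addrC.
rewrite normrM normc_pos ?divr_gt0// => u2.
rewrite -(ltr_pM2l (x := (4 / r)%:C%C)) ?ltcR ?divr_gt0//.
apply: le_lt_trans u2 _; rewrite -rmorphM divfK ?gt_eqF//.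
have -> : (2 : C) = (1 + 1)%:C%C by rewrite rmorphD rmorph1.
by rewrite ltcR; lra.
Qed.

Lemma closed_submodule_separation (F : set (smooth_fun M)) f :
  closed F -> F 0 -> (forall c g h, F g -> F h -> F (c *: g + h)) -> ~ F f ->
  exists2 u : distrib M, (forall g, F g -> u g = 0) & u f != 0.
Proof.
move=> cF F0 Flin Ff.
have /nbhs_jet_controlled[S [cS [e e0 SF]]] : nbhs f (~` F).
  by apply: open_nbhs_nbhs; split=> //; exact: closed_openC.
have [|||||u [lu uF uf ub]] := @separation R (smooth_fun M) (jet_ball S e) F f.
- exact: jet_ball_absorbing.
- exact: jet_ball_absolutely_convex.
- by [].
- exact: Flin.
- move=> g ge; apply: SF => q Sq.
  have iq : chart_img (atlas q.1.1) q.2 by case: cS => + _ _; exact.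
  rewrite -jetB// opprD addNKr -scaleN1r jetZ// mulN1r normrN; exact: ge.
have uD : u \in @distr R n M.
  by apply/mem_set; split=> //; exact: jet_ball_bounded_continuous ub.
by exists (Distrib uD).
Qed.

(** Since jets of f are bounded on S, a^-1 f enters any jet ball for a large
    enough. *)
Lemma set1_bounded f : von_neumann_bounded [set f].
Proof.
move=> U /nbhs_jet_controlled[S [cS [e e0 SU]]].
have [Si Sb _] := cS; have [c c0 fc] := Sb f.
exists (2 * c / e)%:C%C; first by rewrite ltcR divr_gt0// mulr_gt0.
move=> a ra _ ->.
have a0 : 0 < `|a|.
  by apply: lt_le_trans ra; rewrite ltcR divr_gt0// mulr_gt0.
have an0 : a != 0 by rewrite -normr_gt0.
exists (a^-1 *: f); last by rewrite scalerA mulfV// scale1r.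
apply: SU => q Sq; have iq := Si q Sq.
rewrite jet0// sub0r normrN jetZ// normrM normfV ltr_pdivrMl//.
apply: le_lt_trans (fc q Sq) _.
apply: (@lt_le_trans _ _ ((2 * c / e)%:C%C * e%:C%C)).
  by rewrite -rmorphM divfK ?gt_eqF// ltcR ltr_pMl// ltr1n.
by rewrite ler_wpM2r// lecR ltW.
Qed.

Lemma distrib_eval_continuous f :
  continuous (fun u : distrib M => u f : C^o).
Proof.
apply: continuous_complexP => u e e0.
pose E : set (C^o * C^o) := [set z | ball z.1 (e%:C%C : C) z.2].
have entE : entourage E.
  by rewrite -entourage_ballE; exists (e%:C%C) => //=; rewrite ltcR.
have H := @fam_nbhs _ _ _ _ _
  (distrib_val u : {family @von_neumann_bounded _ (smooth_fun M), _ -> C^o})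
  entE (set1_bounded f).
move: H => /(initial_continuous (f := @distrib_val R n M :
  _ -> {family @von_neumann_bounded _ (smooth_fun M), _ -> C^o})) H.
by rewrite nbhs_simpl /= in H; apply: (filterS _ H) => v /(_ f erefl).
Qed.

End smooth_fun_tvs.

(** * Finiteness of the volume and bilinearity of the pairing *)

(** The integral of a nonnegative function is the supremum of the integrals of
    the simple functions below it, hence monotone even for functions whose
    measurability is unknown, such as the inner integrals of an iterated
    integral. *)
Lemma ge0_integral_mono d (T : measurableType d) (R : realType)
    (mu : {measure set T -> \bar R}) (f g : T -> \bar R) :
  (forall x, 0 <= f x)%E -> (forall x, f x <= g x)%E ->
  (\int[mu]_x f x <= \int[mu]_x g x)%E.
Proof.
move=> f0 fg; have g0 x : (0 <= g x)%E by exact: le_trans (f0 x) (fg x).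
rewrite !ge0_integralTE//; apply: ge_ereal_sup => _ [h /= hf <-].
apply: ereal_sup_ubound; exists h => //= x.
exact: le_trans (hf x) (fg x).
Qed.

(** A function with values in [0, c] that vanishes outside the box [-r, r]^n has
    iterated integral at most c (2 r)^n, by induction on n; for |t| > r the
    inner integral vanishes by the induction hypothesis with c = 0. *)
Lemma lebesgue_integral_Rn_bounds (R : realType) (n : nat) (r c : R)
    (F : 'rV[R]_n -> \bar R) : 0 < r -> 0 <= c ->
  (forall y, 0 <= F y <= c%:E)%E ->
  (forall (y : 'rV[R]_n) (j : 'I_n), r < `|y 0 j| -> F y = 0%E) ->
  (0 <= lebesgue_integral_Rn F <= (c * (2 * r) ^+ n)%:E)%E.
Proof.
move=> r0; elim: n c F => [|n IH] c F c0 Fc F0 /=; first by rewrite expr0 mulr1.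
pose G t (y : 'rV[R]_n) := F (row_mx (t%:M : 'M[R]_1) y).
have Gc t : (forall y, 0 <= G t y <= c%:E)%E by move=> y; exact: Fc.
have G0 t (y : 'rV[R]_n) (j : 'I_n) : r < `|y 0 j| -> G t y = 0%E.
  rewrite -(row_mxEr (t%:M : 'M[R]_1) y 0 j); exact: F0.
have K0 : 0 <= c * (2 * r) ^+ n.
  by rewrite mulr_ge0// exprn_ge0// mulr_ge0// ltW.
have IG t : (0 <= lebesgue_integral_Rn (G t) <= (c * (2 * r) ^+ n)%:E)%E.
  exact: (IH c (G t) c0 (Gc t) (G0 t)).
have IG0 t : r < `|t| -> lebesgue_integral_Rn (G t) = 0%E.
  move=> rt; have Gt y : G t y = 0%E.
    have tE : row_mx (t%:M : 'M[R]_1) y 0 (lshift n ord0) = t.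
      by rewrite row_mxEl mxE eqxx mulr1n.
    by rewrite -tE in rt; exact: F0 rt.
  have := IH 0 (G t) (lexx _); rewrite mul0r -eq_le => /(_ _ (G0 t)) H.
  by apply/esym/eqP; apply: H => y; rewrite Gt lexx.
apply/andP; split; first by apply: integral_ge0 => t _; have /andP[] := IG t.
pose D := `[- r, r]%classic : set R.
apply: (@le_trans _ _ (\int[lebesgue_measure]_(t in D)
    (cst (c * (2 * r) ^+ n)%:E) t)%E).
  rewrite [leRHS]integral_mkcond; apply: ge0_integral_mono => t.
    by have /andP[] := IG t.
  rewrite /patch; case: ifPn => [_|]; first by have /andP[] := IG t.
  rewrite notin_setE /D /= in_itv /= -ler_norml => /negP; rewrite -ltNge => rt.
  by rewrite IG0.
rewrite integral_cst; last exact: measurable_itv.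
rewrite /D /= lebesgue_measure_itv /= lte_fin gtrN// -EFinB -EFinM lee_fin.
by rewrite opprK exprSr mulrA -mulr2n -[r *+ 2]mulr_natl.
Qed.

Section riemannian_volume.
Context {R : realType} {n : nat} {M : oriented_riemannian_manifold R n}.
Implicit Types (i : chart_index M) (p : M).

Lemma chart_continuous i p : chart_dom (atlas i) p ->
  {for p, continuous (atlas i)}.
Proof.
move=> ip; have := @chart_map_continuous _ _ _ (atlas i).
rewrite continuous_open_subspace; last exact: chart_dom_open.
by apply; exact/mem_set.
Qed.

Lemma density_continuous i y : chart_img (atlas i) y ->
  {for y, continuous (fun z => Num.sqrt (\det (metric i z)))}.
Proof.
move=> iy; apply: continuous_comp; last exact: sqrt_continuous.
have cm k l : {for y, continuous (fun z => metric i z k l)}.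
  by have [+ _] := metric_smooth k l [::] iy.
have FF := nbhs_filter y.
rewrite /determinant; apply: (@cvg_big _ _ _ _ _ _ _ (nbhs y)) => [|s _].
  exact: add_continuous.
apply: (@cvgM _ _ _ FF); first exact: cvg_cst.
apply: (@cvg_big _ _ _ _ _ _ _ (nbhs y)) => [|k _]; last exact: cm.
exact: mul_continuous.
Qed.

(** Continuity is the case of the empty multi-index in the definition of
    smoothness, transported to M by a chart. *)
Lemma smooth_fun_continuous (f : smooth_fun M) :
  continuous (fun p => complex.Re (f p)) /\
  continuous (fun p => complex.Im (f p)).
Proof.
have H (L : R[i] -> R) : (forall i, smooth_on (chart_img (atlas i))
    (fun y => L (f (chart_inv (atlas i) y)))) -> continuous (fun p => L (f p)).
  move=> sL p; have [i ip] := atlas_cover p.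
  have [cL _] := sL i [::] _ (imageP _ ip).
  pose Li := (fun y => L (f (chart_inv (atlas i) y))) \o atlas i.
  have cLi : {for p, continuous Li}.
    by apply: continuous_comp => //; exact: chart_continuous.
  have nE : \forall q \near p, Li q = L (f q).
    have : nbhs p (chart_dom (atlas i)).
      by apply: open_nbhs_nbhs; split=> //; exact: chart_dom_open.
    by apply: filterS => q iq; rewrite /Li /= (chart_mapK (mem_set iq)).
  rewrite /continuous_at -(nbhs_singleton nE).
  by apply: cvg_trans cLi; exact: near_eq_cvg.
by split; apply: H => i; have [] := smooth_fun_on f i.
Qed.

Lemma continuous_borel_measurable (h : M -> R) : continuous h ->
  measurable_fun [set: borel M] h.
Proof.
move=> /continuousP ch.
apply: (measurability _ (measurable_realfun.RGenOpens.measurableE R)).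
move=> _ [_ [a [b ->] <-]]; rewrite setTI; apply: sub_sigma_algebra.
exact/ch/interval_open.
Qed.

Context {mu : {measure set (borel M) -> \bar R}}.
Hypothesis volume_mu : is_riemannian_volume mu.

(** Around a point of a chart the density and the coordinates are bounded, so a
    small open set has its volume bounded by that of a box. *)
Lemma locally_finite_volume p :
  exists A : set M, [/\ open A, A p & (mu (A : set (borel M)) < +oo)%E].
Proof.
have [i ip] := atlas_cover p.
pose y := atlas i p; pose dens z := Num.sqrt (\det (metric i z)).
have iy : chart_img (atlas i) y by exists p.
pose c := dens y + 1; pose r := `|y| + 1.
have r0 : 0 < r by rewrite ltr_wpDl.
have c0 : 0 <= c by rewrite addr_ge0// sqrtr_ge0.
have W1 : \forall z \near y, dens z < c.
  have /cvgrPdist_lt/(_ 1 ltr01) := density_continuous iy.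
  by apply: filterS => z /ltr_distlCDr.
have W2 : \forall z \near y, `|z| < r.
  near=> z; rewrite -[z](subrK y); apply: le_lt_trans (ler_normD _ _) _.
  rewrite /r addrC ltrD2l distrC.
  by near: z; exact: (@cvgr_dist_lt _ _ _ (nbhs y) _ id).
have W : nbhs p (chart_dom (atlas i) `&`
    [set q | dens (atlas i q) < c /\ `|atlas i q| < r]).
  apply: filterI.
    by apply: open_nbhs_nbhs; split=> //; exact: chart_dom_open.
  exact: (chart_continuous ip) (filterI W1 W2).
exists (interior (chart_dom (atlas i) `&`
    [set q | dens (atlas i q) < c /\ `|atlas i q| < r])).
set B := _ `&` _ in W *.
have oB : open (interior B) by exact: open_interior.
split=> //.
rewrite (volume_mu (i := i)); first last.
- by move=> q /interior_subset[].
- exact: sub_sigma_algebra.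
apply: (@le_lt_trans _ _ (c * (2 * r) ^+ n)%:E); last by rewrite ltry.
suff /andP[_] : (0 <= lebesgue_integral_Rn (fun z : 'rV[R]_n =>
    (\1_(atlas i @` interior B) z * dens z)%:E) <= (c * (2 * r) ^+ n)%:E)%E.
  exact.
apply: lebesgue_integral_Rn_bounds => // z.
  rewrite indicE !lee_fin; case: (boolP (z \in _)) => [/set_mem[q]|_].
    by move=> /interior_subset[_ [qc _]] <-; rewrite mul1r sqrtr_ge0 ltW.
  by rewrite mul0r lexx.
move=> j rz; rewrite indicE; case: (boolP (z \in _)) => [/set_mem[q]|_].
  move=> /interior_subset[_ [_ qr]] qz; exfalso; rewrite qz in qr.
  have : `|z 0 j| <= `|z| 
    by rewrite [leRHS]/Num.norm /= mx_normrE; exact: (le_bigmax _ _ (0, j)).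
  by move=> /le_lt_trans/(_ qr); rewrite ltNge (ltW rz).
by rewrite mul0r.
Unshelve. all: by end_near. Qed.

Lemma finite_volume : compact [set: M] -> (mu [set: borel M] < +oo)%E.
Proof.
pose A p := sval (cid (locally_finite_volume p)).
have AP p : [/\ open (A p), A p p & (mu (A p : set (borel M)) < +oo)%E].
  exact: svalP (cid (locally_finite_volume p)).
rewrite compact_cover => /(_ _ [set: M] A)[p _|p _|].
- by have [] := AP p.
- by exists p => //; have [] := AP p.
move=> D _ MD.
have mA p : measurable (A p : set (borel M)).
  by apply: sub_sigma_algebra; have [] := AP p.
have /le_lt_trans := @content_sub_fsum _ _ _ mu _ [set` D] [set: borel M] A
  (finite_fset D) (fun p _ => mA p) measurableT MD.
apply.
rewrite fsbig_finite//= set_fsetK; apply: lte_sum_pinfty => p _.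
by have [] := AP p.
Qed.

Hypothesis compactM : compact [set: M].

Lemma continuous_integrable (h : M -> R) : continuous h ->
  mu.-integrable [set: borel M] (EFin \o h).
Proof.
move=> ch; apply: measurable_bounded_integrable => //.
- exact: finite_volume.
- exact: continuous_borel_measurable.
have [c hc] := compact_continuous_bounded compactM (fun x _ => ch x).
exists c; split; first exact: num_real.
by move=> d cd x _; apply: le_trans (hc x I) (ltW cd).
Qed.

Lemma pairing_linear (a : R[i]) (f g h : smooth_fun M) :
  pairing mu (a *: f + g) h = a * pairing mu f h + pairing mu g h.
Proof.
have [fr fi] := smooth_fun_continuous f.
have [gr gi] := smooth_fun_continuous g.
have [hr hi] := smooth_fun_continuous h.
have cRe (k : smooth_fun M) : continuous (fun p => complex.Re (k p)) ->
    continuous (fun p => complex.Im (k p)) ->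
    continuous (fun p => complex.Re ((k p : R[i]) * h p)) /\
    continuous (fun p => complex.Im ((k p : R[i]) * h p)).
  move=> kr ki; split.
    have -> : (fun p => complex.Re ((k p : R[i]) * h p)) = fun p =>
        complex.Re (k p) * complex.Re (h p) -
        complex.Im (k p) * complex.Im (h p).
      by apply/funext => p; case: (k p); case: (h p).
    move=> p; apply: cvgB; apply: cvgM;
      [exact: kr|exact: hr|exact: ki|exact: hi].
  have -> : (fun p => complex.Im ((k p : R[i]) * h p)) = fun p =>
      complex.Re (k p) * complex.Im (h p) + complex.Im (k p) * complex.Re (h p).
    by apply/funext => p; case: (k p); case: (h p).
  move=> p; apply: cvgD; apply: cvgM;
    [exact: kr|exact: hi|exact: ki|exact: hr].
have [/continuous_integrable ifr /continuous_integrable ifi] := cRe f fr fi.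
have [/continuous_integrable igr /continuous_integrable igi] := cRe g gr gi.
rewrite /pairing /integral_C.
set fR := fun p : M => complex.Re ((f p : R[i]) * h p).
set fI := fun p : M => complex.Im ((f p : R[i]) * h p).
set gR := fun p : M => complex.Re ((g p : R[i]) * h p).
set gI := fun p : M => complex.Im ((g p : R[i]) * h p).
case: a => b c.
have E p : (((b +i* c)%C *: f + g : smooth_fun M) p) =
  ((b +i* c)%C * f p + g p : R[i]) by [].
have mT : measurable [set: borel M] by [].
have integrableZD (x y : R) (u v w : M -> R) :
    mu.-integrable [set: borel M] (EFin \o u) ->
    mu.-integrable [set: borel M] (EFin \o v) ->
    mu.-integrable [set: borel M] (EFin \o w) ->
    \int[mu]_(p in [set: borel M]) (x * u p + y * v p + w p) =
    x * \int[mu]_(p in [set: borel M]) u p +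
    y * \int[mu]_(p in [set: borel M]) v p + \int[mu]_(p in [set: borel M]) w p.
  move=> iu iv iw.
  have ixu : mu.-integrable [set: borel M] (EFin \o (fun p => x * u p)).
    exact: (integrableZl mT x iu).
  have iyv : mu.-integrable [set: borel M] (EFin \o (fun p => y * v p)).
    exact: (integrableZl mT y iv).
  rewrite RintegralD//; last exact: (integrableD mT ixu iyv).
  by rewrite RintegralD// !RintegralZl.
have -> : \int[mu]_p complex.Re
      ((((b +i* c)%C *: f + g : smooth_fun M) p : R[i]) * h p) =
    b * (\int[mu]_p fR p) + (- c) * (\int[mu]_p fI p) + \int[mu]_p gR p.
  rewrite -integrableZD//; congr Rintegral; apply/funext => p.
  rewrite E /fR /fI /gR; case: (f p) (g p) (h p) => [? ?] [? ?] [? ?] /=; ring.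
have -> : \int[mu]_p complex.Im
      ((((b +i* c)%C *: f + g : smooth_fun M) p : R[i]) * h p) =
    b * (\int[mu]_p fI p) + c * (\int[mu]_p fR p) + \int[mu]_p gI p.
  rewrite -integrableZD//; congr Rintegral; apply/funext => p.
  rewrite E /fR /fI /gI; case: (f p) (g p) (h p) => [? ?] [? ?] [? ?] /=; ring.
by apply/eqP; rewrite eq_complex /=; apply/andP; split; apply/eqP; ring.
Qed.

End riemannian_volume.

Lemma pairingC (R : realType) (n : nat) (M : oriented_riemannian_manifold R n)
    (mu : {measure set (borel M) -> \bar R}) (f g : smooth_fun M) :
  pairing mu f g = pairing mu g f.
Proof. by congr integral_C; apply/funext => p; exact: mulrC. Qed.

(** * The smooth range of an operator *)

Section smooth_range.
Context {R : realType} {n : nat} {M : oriented_riemannian_manifold R n}.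
Context {mu : {measure set (borel M) -> \bar R}}.
Hypothesis volume_mu : is_riemannian_volume mu.
Hypothesis compactM : compact [set: M].
Implicit Types (f g : smooth_fun M) (T : distrib M).

Lemma represents_linear (a : R[i]) f g S T :
  represents mu f S -> represents mu g T ->
  represents mu (a *: f + g) (a *: S + T).
Proof.
move=> fS gT h; rewrite (pairing_linear volume_mu compactM) -fS -gT.
by [].
Qed.

Lemma represents0 : represents mu (0 : smooth_fun M) (0 : distrib M).
Proof.
move=> h; have := pairing_linear volume_mu compactM (-1) 0 0 h.
by rewrite mulN1r addNr scaler0 addr0 => ->.
Qed.

Variable P : {linear distrib M -> distrib M}.

Lemma smooth_range_linear (a : R[i]) f g :
  smooth_range mu P f -> smooth_range mu P g -> smooth_range mu P (a *: f + g).
Proof.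
move=> [f' [S f'S fPS]] [g' [T g'T gPT]]; exists (a *: f' + g').
exists (a *: S + T); first exact: represents_linear.
by rewrite linearP; exact: represents_linear.
Qed.

Lemma smooth_range0 : smooth_range mu P 0.
Proof. by exists 0, 0; rewrite ?linear0; exact: represents0. Qed.

(** A distribution vanishing on the range of P is in the kernel of tP. *)
Lemma smooth_range_orthogonal f : closed (smooth_range mu P) ->
  (forall v : distrib M, ker_transpose_distrib mu P v -> v f = 0) ->
  smooth_range mu P f.
Proof.
move=> cP fker; apply: contrapT => Pf.
have [u uP /eqP] := closed_submodule_separation cP smooth_range0
  smooth_range_linear Pf.
by apply; apply: fker => g h /(ex_intro _ g) /uP ->.
Qed.

End smooth_range.

Lemma orthogonal_distrib_kernel (R : realType) (n : nat)
    (M : oriented_riemannian_manifold R n)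
    (mu : {measure set (borel M) -> \bar R}) (P : distrib M -> distrib M)
    (f : smooth_fun M) : smooth_kernel_dense mu P ->
  (forall v : smooth_fun M, ker_transpose_smooth P v -> pairing mu f v = 0) ->
  forall v : distrib M, ker_transpose_distrib mu P v -> v f = 0.
Proof.
move=> dP fP v /dP vP; apply: contrapT => /eqP vf0.
have vf_gt0 : 0 < `|v f| by rewrite normr_gt0.
have cf := @distrib_eval_continuous R n M f v.
have vf : nbhs v [set u : distrib M | `|v f - u f| < `|v f|].
  exact: (@cvgrPdist_lt _ _ _ _ (nbhs_filter v) _ _).1 cf _ vf_gt0.
have [T [[w wP wT] /=]] := vP _ vf.
by rewrite wT pairingC fP// subr0 ltxx.
Qed.

Lemma distrib0 (R : realType) (n : nat) (M : oriented_riemannian_manifold R n)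
  (u : distrib M) : u 0 = 0.
Proof.
have [lu _] := set_mem (distrib_valP u).
by have := lu (-1) 0 0; rewrite scaler0 addr0 scaleN1r addNr.
Qed.

Theorem proposition3p7 (R : realType) (n : nat)
    (M : oriented_riemannian_manifold R n)
    (compactM : compact [set: M]) (connectedM : connected [set: M])
    (mu : {measure set (borel M) -> \bar R})
    (volume_mu : is_riemannian_volume mu)
    (P : {linear distrib M -> distrib M})
    (continuousP : continuous P)
    (smoothP : preserves_smooth mu P)
    (denseP : smooth_kernel_dense mu P) :
  (forall f : smooth_fun M,
     (forall v : smooth_fun M, ker_transpose_smooth P v ->
        pairing mu f v = 0) ->
     (forall v : distrib M, ker_transpose_distrib mu P v ->
        v f = 0)) /\
  (closed (smooth_range mu P) ->
   almost_globally_hypoelliptic mu P /\ weakly_globally_solvable mu P).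
Proof.
have orth f := @orthogonal_distrib_kernel R n M mu P f denseP.
split=> // closedP.
have range f (fP : forall v, ker_transpose_smooth P v -> pairing mu f v = 0) :
    smooth_range mu P f.
  exact: (smooth_range_orthogonal volume_mu compactM closedP (orth f fP)).
split=> [u [f fPu]|f /range[g [T _ fPT]]]; last by exists T.
have [|g [T gT fPT]] := range f; first by move=> v vP; rewrite -fPu vP distrib0.
exists T; first by exists g.
by apply: val_inj; apply/funext => h; rewrite /= fPT fPu.
Qed.
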